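(* Let $\gamma\ge1$, $k\ge1$, let $\mathcal{N}$ be a qubit channel (a quantum channel with input and output space $\mathbb{C}^2$) and let $\mathcal{T}=\mathcal{N}^{\otimes k}$. Then $$\eta_\gamma(\mathcal{T})\le\frac12\sqrt{(1+\gamma)^2-4\gamma\left(\frac{\lambda_{\min}(C_{\mathcal{N}^\dagger\circ\mathcal{N}})}{4}\right)^k}+\frac{1-\gamma}{2},$$ where $C_{\mathcal{N}^\dagger\circ\mathcal{N}}$ is the Choi matrix of $\mathcal{N}^\dagger\circ\mathcal{N}$ and $\lambda_{\min}(C_{\mathcal{N}^\dagger\circ\mathcal{N}})$ is its smallest eigenvalue. If $\mathcal{N}$ is moreover non-unital (that is, $\mathcal{N}(I)\ne I$), then $$\lambda_{\min}(C_{\mathcal{N}^\dagger\circ\mathcal{N}})>0.$$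
   Context: A quantum channel is a completely positive trace-preserving map. $\mathcal{N}^\dagger$ is the adjoint of $\mathcal{N}$ with respect to the Hilbert–Schmidt inner product. The Choi matrix of a linear map $\mathcal{M}$ on $d\times d$ matrices is $C_{\mathcal{M}}=\sum_{i,j=1}^d\mathcal{M}(|i\rangle\langle j|)\otimes|i\rangle\langle j|$, with $\{|i\rangle\}$ the standard basis of $\mathbb{C}^d$. For $\gamma\ge1$, $E_\gamma(\rho\|\sigma)=\operatorname{Tr}(\rho-\gamma\sigma)^+$, where $X^+$ is the positive part of a Hermitian operator $X$, and the contraction coefficient is $\eta_\gamma(\mathcal{T})=\sup_{\rho,\sigma}E_\gamma(\mathcal{T}(\rho)\|\mathcal{T}(\sigma))/E_\gamma(\rho\|\sigma)$ over quantum states $\rho,\sigma$ with $E_\gamma(\rho\|\sigma)>0$. *)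

(* Defs.v *)
From HB Require Import structures.
From mathcomp Require Import all_boot all_order all_algebra.
From mathcomp Require Import complex.
From mathcomp Require Import character.
From mathcomp Require Import classical_sets reals ereal constructive_ereal.

Set Implicit Arguments.
Unset Strict Implicit.
Unset Printing Implicit Defensive.

Import Order.TTheory GRing.Theory Num.Theory Num.Def.

Local Open Scope ring_scope.
Local Open Scope complex_scope.
Local Open Scope sesquilinear_scope.
Local Open Scope classical_set_scope.

(* Kronecker product: the block matrix with blocks A i j *: B. *)
Notation "A '*t' B" := (tprod A B)
  (at level 40, left associativity) : ring_scope.

Section KroneckerFacts.
Variable F : fieldType.

Lemma tprodDZl m m' n n' (B : 'M[F]_(n, n')) a (A1 A2 : 'M[F]_(m, m')) :
  (a *: A1 + A2) *t B = a *: (A1 *t B) + A2 *t B.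
Proof.
elim: m m' A1 A2 => [|m IH] m' A1 A2 /=; first by rewrite scaler0 addr0.
have u (M1 M2 : 'M[F]_(1 + m, m')) :
    usubmx (a *: M1 + M2) = a *: usubmx M1 + usubmx M2 by rewrite linearP.
have d (M1 M2 : 'M[F]_(1 + m, m')) :
    dsubmx (a *: M1 + M2) = a *: dsubmx M1 + dsubmx M2 by rewrite linearP.
rewrite u d IH -!trowbE linearP.
by rewrite scale_col_mx add_col_mx.
Qed.

Lemma tprodDZr m m' n n' (A : 'M[F]_(m, m')) a (B1 B2 : 'M[F]_(n, n')) :
  A *t (a *: B1 + B2) = a *: (A *t B1) + A *t B2.
Proof.
elim: m m' A => [|m IH] m' A /=; first by rewrite scaler0 addr0.
by rewrite linearP IH scale_col_mx add_col_mx.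
Qed.

Lemma tprod_suml (I : finType) m m' n n' (B : 'M[F]_(n, n'))
    (c : I -> F) (A : I -> 'M[F]_(m, m')) :
  (\sum_i c i *: A i) *t B = \sum_i c i *: (A i *t B).
Proof.
elim/big_rec2: _ => [|i x y _ <-]; last by rewrite tprodDZl.
by have := tprodDZl B (-1) (0 : 'M[F]_(m, m')) 0;
  rewrite scaler0 addr0 scaleN1r addNr.
Qed.

Lemma tprod_sumr (I : finType) m m' n n' (A : 'M[F]_(m, m'))
    (c : I -> F) (B : I -> 'M[F]_(n, n')) :
  A *t (\sum_i c i *: B i) = \sum_i c i *: (A *t B i).
Proof.
elim/big_rec2: _ => [|i x y _ <-]; last by rewrite tprodDZr.
by have := tprodDZr A (-1) (0 : 'M[F]_(n, n')) 0;
  rewrite scaler0 addr0 scaleN1r addNr.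
Qed.

Lemma mxtrace_delta_mul n (A : 'M[F]_n) i j : \tr (delta_mx j i *m A) = A i j.
Proof.
rewrite /mxtrace (bigD1 j) //= big1 => [|k /negPf nk]; rewrite !mxE.
  rewrite addr0 (bigD1 i) //= big1 => [|l /negPf nl];
    rewrite mxE ?eqxx ?mul1r ?addr0 //.
  by rewrite nl andbF mul0r.
by rewrite big1 // => l _; rewrite mxE nk mul0r.
Qed.

End KroneckerFacts.

Section Defs.
Variable R : realType.
Local Notation C := R[i].

(* In R[i], [0 <= z] says that z is real and nonnegative; hence a positive
   semidefinite matrix is automatically Hermitian. *)
Definition psdmx n (A : 'M[C]_n) : Prop :=
  forall v : 'cV[C]_n, 0 <= (v^t* *m A *m v) 0 0.

Definition qstate n (rho : 'M[C]_n) : Prop := psdmx rho /\ \tr rho = 1.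

(* (Phi ⊗ Psi) X for linear Phi and Psi, by expanding X in the product matrix
   units: X = \sum_(i, j, k, l) \tr ((E_ji ⊗ E_lk) X) E_ij ⊗ E_kl.
   See [tensopM] and [tensop_linear]. *)
Definition tensop m m' n n' (Phi : 'M[C]_m -> 'M[C]_m')
    (Psi : 'M[C]_n -> 'M[C]_n') (X : 'M[C]_(m * n)) : 'M[C]_(m' * n') :=
  \sum_(i < m) \sum_(j < m) \sum_(k < n) \sum_(l < n)
    \tr ((delta_mx j i *t delta_mx l k) *m X) *:
      (Phi (delta_mx i j) *t Psi (delta_mx k l)).

(* [tdim d k] is d ^ k (see [tdimE]), in a form for which
   [tdim d k.+1] and [d * tdim d k] are convertible. *)
Fixpoint tdim (d k : nat) : nat := if k is k'.+1 then (d * tdim d k')%N else 1%N.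

Fixpoint tensop_pow m n (Phi : 'M[C]_m -> 'M[C]_n) (k : nat) :
    'M[C]_(tdim m k) -> 'M[C]_(tdim n k) :=
  if k is k'.+1 return 'M[C]_(tdim m k) -> 'M[C]_(tdim n k)
  then tensop Phi (@tensop_pow m n Phi k') else id.

Definition completely_positive m n (Phi : 'M[C]_m -> 'M[C]_n) : Prop :=
  forall (k : nat) (X : 'M[C]_(k * m)),
    psdmx X -> psdmx (tensop (@id 'M[C]_k) Phi X).

Definition trace_preserving m n (Phi : 'M[C]_m -> 'M[C]_n) : Prop :=
  forall X, \tr (Phi X) = \tr X.

Definition qchannel m n (N : {linear 'M[C]_m -> 'M[C]_n}) : Prop :=
  completely_positive N /\ trace_preserving N.

(* Adjoint for the Hilbert-Schmidt inner product <A, B> = \tr (A^t* *m B),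
   given by its entries <E_ij, hsadj Phi Y> = <Phi E_ij, Y>; see [hsadjP]. *)
Definition hsadj m n (Phi : 'M[C]_m -> 'M[C]_n) (Y : 'M[C]_n) : 'M[C]_m :=
  \matrix_(i, j) \tr ((Phi (delta_mx i j))^t* *m Y).

Definition choi m n (Phi : 'M[C]_m -> 'M[C]_n) : 'M[C]_(n * m) :=
  \sum_(i < m) \sum_(j < m) Phi (delta_mx i j) *t delta_mx i j.

(* Meant for Hermitian matrices of positive size, whose set of eigenvalues is
   finite, nonempty and real, so that the infimum is a minimum. *)
Definition lambda_min n (A : 'M[C]_n) : R := inf [set x : R | eigenvalue A x%:C].

(* X^+, meant for Hermitian X: the spectral decomposition
   X = P^-1 *m diag_mx d *m P has P unitary and d real. *)
Definition pospart n (X : 'M[C]_n) : 'M[C]_n :=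
  invmx (spectralmx X) *m diag_mx (map_mx (Num.max 0) (spectral_diag X))
    *m spectralmx X.

Definition hockey_stick n (gamma : R) (rho sigma : 'M[C]_n) : R :=
  complex.Re (\tr (pospart (rho - gamma%:C *: sigma))).

Definition contraction_coeff m n (gamma : R) (T : 'M[C]_m -> 'M[C]_n) : \bar R :=
  ereal_sup [set x | exists rho sigma : 'M[C]_m,
    [/\ qstate rho, qstate sigma, 0 < hockey_stick gamma rho sigma &
        x = (hockey_stick gamma (T rho) (T sigma)
               / hockey_stick gamma rho sigma)%:E]].

Lemma tdimE d k : tdim d k = (d ^ k)%N.
Proof. by elim: k => //= k ->; rewrite expnS. Qed.

Lemma tensop_linear m m' n n' (Phi : 'M[C]_m -> 'M[C]_m')
    (Psi : 'M[C]_n -> 'M[C]_n') : linear (tensop Phi Psi).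
Proof.
move=> a X Y; rewrite /tensop.
do 4 (rewrite scaler_sumr -big_split; apply: eq_bigr => ? _ /=).
by rewrite linearP linearP /= scalerDl scalerA.
Qed.

Lemma linear_delta p q (f : {linear 'M[C]_p -> 'M[C]_q}) (M : 'M[C]_p) :
  f M = \sum_(ij : 'I_p * 'I_p) M ij.1 ij.2 *: f (delta_mx ij.1 ij.2).
Proof.
rewrite {1}[M]matrix_sum_delta pair_big linear_sum /=.
by apply: eq_bigr => ij _; rewrite linearZ.
Qed.

Lemma tensopM m m' n n' (Phi : {linear 'M[C]_m -> 'M[C]_m'})
    (Psi : {linear 'M[C]_n -> 'M[C]_n'}) (A : 'M[C]_m) (B : 'M[C]_n) :
  tensop Phi Psi (A *t B) = Phi A *t Psi B.
Proof.
rewrite (linear_delta Phi) (linear_delta Psi).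
rewrite tprod_suml /tensop pair_big; apply: eq_bigr => -[i j] _ /=.
rewrite tprod_sumr scaler_sumr pair_big; apply: eq_bigr => -[k l] _ /=.
by rewrite -tprodE mxtrace_prod !mxtrace_delta_mul scalerA.
Qed.

Lemma hsadjP m n (Phi : {linear 'M[C]_m -> 'M[C]_n}) (Psi : 'M[C]_n -> 'M[C]_m) :
  (forall A Y, \tr (A^t* *m Psi Y) = \tr ((Phi A)^t* *m Y)) <->
  Psi =1 hsadj Phi.
Proof.
have tr_delta i j (M : 'M[C]_m) : \tr ((delta_mx i j)^t* *m M) = M i j.
  by rewrite trmx_delta map_delta_mx mxtrace_delta_mul.
split=> [adj Y | eqP A Y].
  by apply/matrixP => i j; rewrite mxE -adj tr_delta.
have hs_sum p (c : 'I_m * 'I_m -> C) (M : 'I_m * 'I_m -> 'M[C]_p) L :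
    \tr ((\sum_ij c ij *: M ij)^t* *m L)
      = \sum_ij (c ij)^* * \tr ((M ij)^t* *m L).
  elim/big_rec2: _ => [|ij x B _ <-].
    by rewrite trmx0 map_mx0 mul0mx mxtrace0.
  by rewrite linearP map_mxD map_mxZ mulmxDl -scalemxAl mxtraceD mxtraceZ.
rewrite (linear_delta Phi) eqP.
rewrite -[in LHS](erefl : idfun A = A) (linear_delta idfun) !hs_sum.
by apply: eq_bigr => -[i j] _; rewrite tr_delta mxE.
Qed.

End Defs.

Arguments tensop_pow {R m n} Phi k _.

(* Main.v *)
(* Bound.  Write rho - gamma sigma = P - Q with P, Q >= 0 and normalise P and Q
   to states P', Q'.  Then tr P <= 1 gives tr Q >= gamma tr P, so the ratio is
   at most a - gamma b, where a and b are the weights of T P' and T Q' on the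
   positive eigenspace of T (rho - gamma sigma).  The overlap satisfies
   tr (T P' T Q') <= 2 (a b + (1 - a) (1 - b)), and it is at least lambda^k
   because the Choi matrix of T^* T is a reordered tensor power of that of
   N^* N.  The factor 2 is absorbed by 4^k.

   Strict positivity.  A kernel vector V of the Choi matrix of N^* N satisfies
   w (V x 1) w = 0, where w is the Choi matrix of N.  Trace preservation makes V
   traceless.  Since XY + YX = (tr X) Y + (tr Y) X modulo scalars for 2 x 2
   matrices, tracing out the input of
   (V^* x 1) w (V x 1) w + (V x 1) w (V^* x 1) w shows that a nonzero multiple
   of N 1 is scalar, hence N 1 = 1. *)

Require Import Defs.
From HB Require Import structures.
From mathcomp Require Import all_boot all_order all_algebra.
From mathcomp Require Import complex character ring lra.
From mathcomp Require Import classical_sets reals ereal constructive_ereal.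

Set Implicit Arguments.
Unset Strict Implicit.
Unset Printing Implicit Defensive.

Import Order.TTheory GRing.Theory Num.Theory.

Local Open Scope ring_scope.
Local Open Scope sesquilinear_scope.

(** * Positive semidefinite kernels on finite types *)

Section PsdKernels.
Variable C : numClosedFieldType.
Implicit Types I J : finType.

(** Conjugate-linear in the first vector. Kernels live on arbitrary finite types so that index pairs
    of bipartite systems can be used without flattening. *)
Definition sform I (K : I -> I -> C) (u w : I -> C) : C :=
  \sum_i \sum_j (u i)^* * K i j * w j.

Definition psdk I (K : I -> I -> C) : Prop := forall v, 0 <= sform K v v.

Lemma sformDZl I (K : I -> I -> C) c u u' w :
  sform K (fun x => u x + c * u' x) w = sform K u w + c^* * sform K u' w.
Proof.
rewrite /sform mulr_sumr -big_split; apply: eq_bigr => i _ /=.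
rewrite mulr_sumr -big_split; apply: eq_bigr => j _ /=.
by rewrite rmorphD rmorphM /=; ring.
Qed.

Lemma sformDZr I (K : I -> I -> C) c u w w' :
  sform K u (fun x => w x + c * w' x) = sform K u w + c * sform K u w'.
Proof.
rewrite /sform mulr_sumr -big_split; apply: eq_bigr => i _ /=.
rewrite mulr_sumr -big_split; apply: eq_bigr => j _ /=.
by ring.
Qed.

Lemma sform_delta I (K : I -> I -> C) i j :
  sform K (fun x => (x == i)%:R) (fun x => (x == j)%:R) = K i j.
Proof.
rewrite /sform (bigD1 i) //= [X in _ + X]big1 => [|i' /negPf ni]; last first.
  by rewrite big1 // => j' _; rewrite ni conjC0 !mul0r.
rewrite addr0 (bigD1 j) //= big1 => [|j' /negPf nj]; last by rewrite nj mulr0.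
by rewrite !eqxx conjC1 mul1r mulr1 addr0.
Qed.

(** Polarisation: positivity at a combination of two basis vectors makes [c * K i j + c^* * K j i]
    real for every [c]. The choices [c = 1] and [c = 'i] then determine [K j i]. *)
Lemma psdk_herm I (K : I -> I -> C) i j : psdk K -> K j i = (K i j)^*.
Proof.
move=> Kp.
pose di x : C := (x == i)%:R; pose dj x : C := (x == j)%:R.
have real_cross c : c * K i j + c^* * K j i \is Num.real.
  have := Kp (fun x => di x + c * dj x).
  rewrite sformDZl !sformDZr !sform_delta => h.
  have -> : c * K i j + c^* * K j i =
     (K i i + c * K i j + c^* * (K j i + c * K j j)) - K i i - (c * c^*) * K j j
    by ring.
  have diag_ge0 x : 0 <= K x x by rewrite -(sform_delta K x x); apply: Kp.
  have hr : c * c^* * K j j \is Num.real.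
    by apply/ger0_real/mulr_ge0 => //; apply: mul_conjC_ge0.
  by rewrite !rpredB //; apply: ger0_real.
have h1 := CrealP (real_cross 1); have hi := CrealP (real_cross 'i).
move: h1 hi.
rewrite !(rmorphD, rmorphM) /= !conjCK conjC1 conjCi !mul1r => h1 hi.
have hi' : (K j i)^* - (K i j)^* = K i j - K j i.
  by apply: (mulfI (neq0Ci C)); rewrite !mulrBr; move: hi; rewrite !mulNr addrC.
apply: (@mulfI _ 2); first by rewrite pnatr_eq0.
have -> : 2 * K j i = (K i j + K j i) - (K i j - K j i) by ring.
by rewrite -h1 -hi'; ring.
Qed.

Lemma sform_gram I J (f : J -> I -> C) v :
  sform (fun i j => \sum_r f r i * (f r j)^*) v v =
    \sum_r (\sum_i (v i)^* * f r i) * (\sum_i (v i)^* * f r i)^*.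
Proof.
rewrite /sform; under eq_bigr => i _ do under eq_bigr => j _ do
  rewrite mulr_sumr mulr_suml.
under eq_bigr => i _ do rewrite exchange_big.
rewrite exchange_big; apply: eq_bigr => r _.
rewrite rmorph_sum mulr_suml; apply: eq_bigr => i _.
rewrite mulr_sumr; apply: eq_bigr => j _.
by rewrite rmorphM /= conjCK; ring.
Qed.

Lemma gram_psdk I J (f : J -> I -> C) :
  psdk (fun i j => \sum_r f r i * (f r j)^*).
Proof.
by move=> v; rewrite sform_gram; apply: sumr_ge0 => r _; apply: mul_conjC_ge0.
Qed.

Lemma eq_psdk I (K K' : I -> I -> C) : K =2 K' -> psdk K -> psdk K'.
Proof.
move=> e Kp v; have := Kp v; congr (0 <= _).
by apply: eq_bigr => i _; apply: eq_bigr => j _; rewrite e.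
Qed.

Lemma herm_spectral n (A : 'M[C]_n) : A^t* = A ->
  let U := spectralmx A in let d := spectral_diag A in
  [/\ U \is unitarymx, A = U^t* *m diag_mx d *m U &
      forall r, d 0 r = (U *m A *m U^t*) r r /\ d 0 r \is Num.real].
Proof.
move=> Ah U d; have Uu : U \is unitarymx := spectral_unitarymx A.
have herm : A \is hermsymmx by apply/is_hermitianmxP; rewrite expr0 scale1r Ah.
have /orthomx_spectralP AE := hermitian_normalmx herm.
rewrite invmx_unitary // -/U -/d in AE; split=> // r.
have -> : U *m A *m U^t* = diag_mx d.
  rewrite AE !mulmxA (unitarymxP Uu) mul1mx -mulmxA (unitarymxP Uu).
  by rewrite mulmx1.
rewrite mxE eqxx mulr1n; split=> //.
by have /mxOverP := hermitian_spectral_diag_real herm; apply.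
Qed.

(** The last clause exhibits each eigenvalue as the value of the form at its eigenvector. This gives
    nonnegativity here and a kernel vector in [lambda_min_gt0]. *)
Lemma psd_spectral n (A : 'M[C]_n) : psdk (fun i j => A i j) ->
  exists (U : 'M[C]_n) (d : 'I_n -> C), [/\ U \is unitarymx,
    forall i j, A i j = \sum_r d r * ((U r i)^* * U r j) &
    forall r, 0 <= d r /\
      d r = sform (fun i j => A i j) (fun i => (U r i)^*) (fun i => (U r i)^*)].
Proof.
move=> Ap; have [|Uu AE dE] := @herm_spectral _ A.
  by apply/matrixP => i j; rewrite !mxE -(psdk_herm j i Ap).
set U := spectralmx A in Uu AE dE; set d := spectral_diag A in AE dE.
have dF r : d 0 r =
    sform (fun i j => A i j) (fun i => (U r i)^*) (fun i => (U r i)^*).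
  rewrite (dE r).1 mxE /sform exchange_big; apply: eq_bigr => j _ /=.
  rewrite !mxE mulr_suml; apply: eq_bigr => i _ /=.
  by rewrite conjCK.
exists U, (d 0); split=> // [i j|r]; last by rewrite {1}dF; split.
rewrite AE mul_mx_diag mxE; apply: eq_bigr => r _; rewrite !mxE.
by ring.
Qed.

Lemma wgram_psdk I J (w : J -> C) (f : J -> I -> C) : (forall r, 0 <= w r) ->
  psdk (fun i j => \sum_r w r * (f r i * (f r j)^*)).
Proof.
move=> w0; have := gram_psdk (fun r i => sqrtC (w r) * f r i).
apply: eq_psdk => i j; apply: eq_bigr => r _.
rewrite rmorphM /= [(sqrtC _)^*]geC0_conj ?sqrtC_ge0 //.
by rewrite -[in RHS](sqrtCK (w r)); ring.
Qed.

(** Transport to a matrix along the enumeration of [I], diagonalise, and absorb the square roots of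
    the eigenvalues into the vectors. Together with [gram_psdk] this reduces closure properties of
    positive kernels to constructions on Gram vectors. *)
Lemma psdk_gram I (K : I -> I -> C) : psdk K ->
  exists n (f : 'I_n -> I -> C), forall i j, K i j = \sum_r f r i * (f r j)^*.
Proof.
move=> Kp; pose M : 'M[C]_#|I| := \matrix_(x, y) K (enum_val x) (enum_val y).
have Mp : psdk (fun x y => M x y).
  move=> v; have := Kp (fun i => v (enum_rank i)); congr (0 <= _).
  rewrite /sform (reindex _ (onW_bij _ (enum_val_bij I))).
  apply: eq_bigr => x _ /=.
  rewrite (reindex _ (onW_bij _ (enum_val_bij I))); apply: eq_bigr => y _ /=.
  by rewrite !enum_valK mxE.
have [U [d [_ ME d0]]] := psd_spectral Mp.
exists #|I|, (fun r i => (U r (enum_rank i))^* * sqrtC (d r)) => i j.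
have -> : K i j = M (enum_rank i) (enum_rank j) by rewrite mxE !enum_rankK.
rewrite ME; apply: eq_bigr => r _.
rewrite rmorphM /= conjCK [(sqrtC _)^*]geC0_conj ?sqrtC_ge0 ?(d0 r).1 //.
by rewrite -[in LHS](sqrtCK (d r)); ring.
Qed.

Lemma psdkD I (K K' : I -> I -> C) :
  psdk K -> psdk K' -> psdk (fun i j => K i j + K' i j).
Proof.
move=> Kp Kp' v; have := addr_ge0 (Kp v) (Kp' v); congr (0 <= _).
rewrite -big_split; apply: eq_bigr => i _; rewrite -big_split.
by apply: eq_bigr => j _ /=; ring.
Qed.

Lemma psdkZ I (K : I -> I -> C) c :
  0 <= c -> psdk K -> psdk (fun i j => c * K i j).
Proof.
move=> c0 Kp v; have := mulr_ge0 c0 (Kp v); congr (0 <= _).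
rewrite /sform mulr_sumr; apply: eq_bigr => i _; rewrite mulr_sumr.
by apply: eq_bigr => j _ /=; ring.
Qed.

(** Gram vectors pull back along any [h], so this covers principal submatrices, relabellings and
    repeated indices alike. *)
Lemma psdk_comp I J (h : J -> I) (K : I -> I -> C) :
  psdk K -> psdk (fun x y => K (h x) (h y)).
Proof.
case/psdk_gram=> n [f fE].
by apply: eq_psdk (gram_psdk (fun r x => f r (h x))) => x y; rewrite fE.
Qed.

(* Schur product theorem; the Kronecker product is the case of an index pair. *)
Lemma psdkM I (K K' : I -> I -> C) :
  psdk K -> psdk K' -> psdk (fun i j => K i j * K' i j).
Proof.
case/psdk_gram=> n [f fE] /psdk_gram[n' [f' fE']].
apply: eq_psdk (gram_psdk (fun (rs : 'I_n * 'I_n') i => f rs.1 i * f' rs.2 i)).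
move=> i j; rewrite fE fE' mulr_suml.
under [RHS]eq_bigr do rewrite mulr_sumr.
by rewrite pair_big; apply: eq_bigr => -[r s] _; rewrite rmorphM /=; ring.
Qed.

Lemma psdk_id I : psdk (fun i j : I => (i == j)%:R).
Proof.
apply: eq_psdk (gram_psdk (fun r i => (i == r)%:R)) => i j.
rewrite (bigD1 i) //= big1 => [|r /negPf ri]; last first.
  by rewrite eq_sym ri mul0r.
by rewrite eqxx mul1r addr0 conjC_nat eq_sym.
Qed.

Lemma psdk_conj I (K : I -> I -> C) : psdk K -> psdk (fun i j => (K i j)^*).
Proof.
move=> Kp v; have := Kp (fun i => (v i)^*); congr (0 <= _).
rewrite /sform exchange_big; apply: eq_bigr => i _; apply: eq_bigr => j _ /=.
by rewrite conjCK (psdk_herm i j Kp); ring.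
Qed.

(** Expanding [K] in Gram vectors turns the Hilbert-Schmidt pairing into a sum of values of the form
    of [K']. Positivity of a channel and the overlap bound are both instances. *)
Lemma psdk_conj_pairing_ge0 I (K K' : I -> I -> C) :
  psdk K -> psdk K' -> 0 <= \sum_i \sum_j (K i j)^* * K' i j.
Proof.
case/psdk_gram=> n [f fE] K'p.
have -> : \sum_i \sum_j (K i j)^* * K' i j = \sum_r sform K' (f r) (f r).
  rewrite [RHS]exchange_big; apply: eq_bigr => i _ /=.
  rewrite [RHS]exchange_big; apply: eq_bigr => j _ /=.
  rewrite fE rmorph_sum mulr_suml.
  by apply: eq_bigr => r _; rewrite rmorphM /= conjCK; ring.
by apply: sumr_ge0.
Qed.

End PsdKernels.

(** * Kronecker products and tensor powers of channels *)

Section TensorIndex.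
Variables m n : nat.

Fact tidx_subproof (i : 'I_m) (k : 'I_n) : (i * n + k < m * n)%N.
Proof.
apply: (@leq_trans (i.+1 * n)); first by rewrite mulSn addnC ltn_add2r.
by rewrite leq_mul2r ltn_ord orbT.
Qed.
(** Row-major numbering, which is the order in which [tprod] lays out its blocks. *)
Definition tidx i k : 'I_(m * n) := Ordinal (tidx_subproof i k).

Fact tidx1_subproof (x : 'I_(m * n)) : (x %/ n < m)%N.
Proof. by rewrite ltn_divLR // lt0n; case: n x => // -[x]; rewrite muln0. Qed.
Definition tidx1 x : 'I_m := Ordinal (tidx1_subproof x).

Fact tidx2_subproof (x : 'I_(m * n)) : (x %% n < n)%N.
Proof. by rewrite ltn_mod lt0n; case: n x => // -[x]; rewrite muln0. Qed.
Definition tidx2 x : 'I_n := Ordinal (tidx2_subproof x).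

Lemma tidxK x : tidx (tidx1 x) (tidx2 x) = x.
Proof. by apply: val_inj; rewrite /= -divn_eq. Qed.

Lemma tidx1K i k : tidx1 (tidx i k) = i.
Proof.
have n_gt0 : (0 < n)%N by apply: leq_ltn_trans (ltn_ord k).
by apply: val_inj; rewrite /= divnMDl // divn_small ?addn0.
Qed.

Lemma tidx2K i k : tidx2 (tidx i k) = k.
Proof. by apply: val_inj; rewrite /= modnMDl modn_small. Qed.

Lemma tidx_eq i k j l : (tidx i k == tidx j l) = (i == j) && (k == l).
Proof.
apply/eqP/andP => [e|[/eqP-> /eqP->] //].
move/(congr1 tidx1): (e); move/(congr1 tidx2): e.
by rewrite !tidx1K !tidx2K => -> ->.
Qed.

Lemma tidx_eql i k x : (tidx i k == x) = (i == tidx1 x) && (k == tidx2 x).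
Proof. by rewrite -{1}(tidxK x) tidx_eq. Qed.

Lemma eq_tidx x y : (x == y) = (tidx1 x == tidx1 y) && (tidx2 x == tidx2 y).
Proof. by rewrite -{1}(tidxK x) -{1}(tidxK y) tidx_eq. Qed.

End TensorIndex.

Section KroneckerEntries.
Variable F : fieldType.

Lemma trow_tidx n1 m2 n2 (A : 'rV[F]_n1) (B : 'M[F]_(m2, n2)) k j l :
  trow A B k (tidx j l) = A 0 j * B k l.
Proof.
elim: n1 A j => [|n1 IH] A j /=; first by case: j.
case: (unliftP 0 j) => [j'|] ->.
  have -> : tidx (lift 0 j') l = rshift n2 (tidx j' l).
    by apply: val_inj; rewrite /= /bump leq0n add1n mulSn addnA.
  rewrite row_mxEr IH mxE; congr (A _ _ * _); exact: val_inj.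
have -> : tidx 0 l = lshift (n1 * n2) l by apply: val_inj.
by rewrite row_mxEl !mxE; congr (A _ _ * _); apply: val_inj.
Qed.

Lemma tprod_tidx m1 n1 m2 n2 (A : 'M[F]_(m1, n1)) (B : 'M[F]_(m2, n2)) i k j l :
  (A *t B) (tidx i k) (tidx j l) = A i j * B k l.
Proof.
elim: m1 A i => [|m1 IH] A i /=; first by case: i.
case: (unliftP 0 i) => [i'|] ->.
  have -> : tidx (lift 0 i') k = rshift m2 (tidx i' k).
    by apply: val_inj; rewrite /= /bump leq0n add1n mulSn addnA.
  rewrite col_mxEd IH mxE; congr (A _ _ * _); exact: val_inj.
have -> : tidx 0 k = lshift (m1 * m2) k by apply: val_inj.
rewrite col_mxEu trow_tidx mxE; congr (A _ _ * _); exact: val_inj.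
Qed.

Lemma tprodEx m1 n1 m2 n2 (A : 'M[F]_(m1, n1)) (B : 'M[F]_(m2, n2)) x y :
  (A *t B) x y = A (tidx1 x) (tidx1 y) * B (tidx2 x) (tidx2 y).
Proof. by rewrite -{1}(tidxK x) -{1}(tidxK y) tprod_tidx. Qed.

Lemma tprod_delta m1 n1 m2 n2 (i : 'I_m1) (j : 'I_n1) (k : 'I_m2) (l : 'I_n2) :
  delta_mx i j *t delta_mx k l = delta_mx (tidx i k) (tidx j l) :> 'M[F]_(_, _).
Proof.
apply/matrixP => x y; rewrite tprodEx !mxE -{3}(tidxK x) -{3}(tidxK y) !tidx_eq.
by rewrite -natrM mulnb; congr (_ _ )%:R; do 4 case: eqP.
Qed.

End KroneckerEntries.

Section KroneckerConj.
Variable C : numClosedFieldType.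

Lemma tprod_trmxC m1 n1 m2 n2 (A : 'M[C]_(m1, n1)) (B : 'M[C]_(m2, n2)) :
  (A *t B)^t* = A^t* *t B^t*.
Proof. by apply/matrixP => x y; rewrite !(mxE, tprodEx) rmorphM. Qed.

End KroneckerConj.

(** * Choi and Gram kernels of a map, and their behaviour under tensor products *)

Section Channels.
Variable R : realType.
Local Notation C := R[i].

Lemma psdmxP n (A : 'M[C]_n) : psdmx A <-> psdk (fun i j => A i j).
Proof.
suff e (v : 'cV[C]_n) :
    (v^t* *m A *m v) 0 0 = sform (fun i j => A i j) (v^~ 0) (v^~ 0).
  split=> h v; last by rewrite e.
  have := h (\col_i v i); rewrite e; congr (0 <= _).
  by apply: eq_bigr => i _; apply: eq_bigr => j _; rewrite !mxE.
rewrite mxE /sform exchange_big; apply: eq_bigr => j _ /=.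
by rewrite mxE mulr_suml; apply: eq_bigr => i _; rewrite !mxE.
Qed.

Lemma tensopE m m' n n' (Phi : 'M[C]_m -> 'M[C]_m')
    (Psi : 'M[C]_n -> 'M[C]_n') X :
  tensop Phi Psi X = \sum_i \sum_j \sum_k \sum_l X (tidx i k) (tidx j l) *:
      (Phi (delta_mx i j) *t Psi (delta_mx k l)).
Proof.
do 4 (apply: eq_bigr => ? _).
by rewrite tprod_delta mxtrace_delta_mul.
Qed.

Lemma tensop_delta m m' n n' (Phi : 'M[C]_m -> 'M[C]_m')
    (Psi : 'M[C]_n -> 'M[C]_n') x y :
  tensop Phi Psi (delta_mx x y) =
    Phi (delta_mx (tidx1 x) (tidx1 y)) *t Psi (delta_mx (tidx2 x) (tidx2 y)).
Proof.
rewrite tensopE (bigD1 (tidx1 x)) //= [X in _ + X]big1 ?addr0; last first.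
  move=> i /negPf ni; do 3 (rewrite big1 // => ? _).
  by rewrite mxE !tidx_eql ni scale0r.
rewrite (bigD1 (tidx1 y)) //= [X in _ + X]big1 ?addr0; last first.
  move=> i /negPf ni; do 2 (rewrite big1 // => ? _).
  by rewrite mxE !tidx_eql ni andbF scale0r.
rewrite (bigD1 (tidx2 x)) //= [X in _ + X]big1 ?addr0; last first.
  move=> i /negPf ni; rewrite big1 // => ? _.
  by rewrite mxE !tidx_eql ni andbF scale0r.
rewrite (bigD1 (tidx2 y)) //= [X in _ + X]big1 ?addr0; last first.
  move=> i /negPf ni.
  by rewrite mxE !tidx_eql ni !andbF scale0r.
by rewrite !tidxK mxE !eqxx scale1r.
Qed.

(* The Choi matrix of Phi, with the input index first. *)
Definition choik m n (Phi : 'M[C]_m -> 'M[C]_n) (x y : 'I_m * 'I_n) : C :=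
  Phi (delta_mx x.1 y.1) x.2 y.2.

(** The Choi matrix of [hsadj Phi \o Phi] read on index pairs; see [choi_hsadj_tidx]. In this form a
    tensor product of maps gives an entrywise product of reindexed kernels. *)
Definition gramk m n (Phi : 'M[C]_m -> 'M[C]_n) (x y : 'I_m * 'I_m) : C :=
  \tr ((Phi (delta_mx x.1 y.1))^t* *m Phi (delta_mx x.2 y.2)).

Lemma choik_tensop m m' n n' (Phi : 'M[C]_m -> 'M[C]_m')
    (Psi : 'M[C]_n -> 'M[C]_n') x y :
  choik (tensop Phi Psi) x y =
    choik Phi (tidx1 x.1, tidx1 x.2) (tidx1 y.1, tidx1 y.2) *
    choik Psi (tidx2 x.1, tidx2 x.2) (tidx2 y.1, tidx2 y.2).
Proof. by rewrite /choik tensop_delta tprodEx. Qed.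

Lemma gramk_tensop m m' n n' (Phi : 'M[C]_m -> 'M[C]_m')
    (Psi : 'M[C]_n -> 'M[C]_n') x y :
  gramk (tensop Phi Psi) x y =
    gramk Phi (tidx1 x.1, tidx1 x.2) (tidx1 y.1, tidx1 y.2) *
    gramk Psi (tidx2 x.1, tidx2 x.2) (tidx2 y.1, tidx2 y.2).
Proof. by rewrite /gramk !tensop_delta tprod_trmxC -tprodE mxtrace_prod. Qed.

(** Complete positivity is applied with an ancilla of the input dimension, to an unnormalised
    maximally entangled state. *)
Lemma cp_choik m n (Phi : 'M[C]_m -> 'M[C]_n) :
  completely_positive Phi -> psdk (choik Phi).
Proof.
move=> cp.
(* [X] is the sum of all [delta_mx i j *t delta_mx i j]. It has rank one, so a single Gram vector
   suffices. *)
pose X : 'M[C]_(m * m) :=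
  \matrix_(x, y) ((tidx1 x == tidx2 x)%:R * (tidx1 y == tidx2 y)%:R).
have Xp : psdmx X.
  apply/psdmxP; apply: eq_psdk (gram_psdk
    (fun (r : 'I_1) (x : 'I_(m * m)) => (tidx1 x == tidx2 x)%:R)) => x y.
  by rewrite big_ord1 mxE conjC_nat.
have /psdmxP Yp := cp _ _ Xp.
apply: eq_psdk (psdk_comp (fun x => tidx x.1 x.2) Yp) => -[i p] [j q].
rewrite /choik /= tensopE summxE.
rewrite (bigD1 i) //= [X in _ + X]big1 ?addr0; last first.
  move=> i' /negPf ni; rewrite summxE big1 // => j' _.
  rewrite summxE big1 // => k' _.
  rewrite summxE big1 // => l' _; rewrite mxE tprod_tidx.
  by rewrite [X in _ * (X * _)]mxE eq_sym ni mul0r mulr0.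
rewrite summxE (bigD1 j) //= [X in _ + X]big1 ?addr0; last first.
  move=> j' /negPf ni; rewrite summxE big1 // => k' _.
  rewrite summxE big1 // => l' _; rewrite mxE tprod_tidx.
  by rewrite [X in _ * (X * _)]mxE [j == _]eq_sym ni andbF mul0r mulr0.
rewrite summxE (bigD1 i) //= [X in _ + X]big1 ?addr0; last first.
  move=> k' /negPf ni; rewrite summxE big1 // => l' _.
  by rewrite !mxE tidx1K tidx2K eq_sym ni !mul0r.
rewrite summxE (bigD1 j) //= [X in _ + X]big1 ?addr0; last first.
  move=> l' /negPf ni.
  by rewrite !mxE !tidx1K !tidx2K [j == _]eq_sym ni mulr0 mul0r.
by rewrite !mxE tprod_tidx mxE !tidx1K !tidx2K !eqxx !mul1r.
Qed.

Lemma psd_trmxC n (A : 'M[C]_n) : psdmx A -> A^t* = A.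
Proof.
by move=> /psdmxP Ap; apply/matrixP => i j; rewrite !mxE -(psdk_herm j i Ap).
Qed.

(** The value of the form of [Phi A] at [w] is the pairing of [choik Phi] with the tensor product of
    the conjugate of [A] and the rank-one kernel of [w]. *)
Lemma choik_positive m n (Phi : {linear 'M[C]_m -> 'M[C]_n}) A :
  psdk (choik Phi) -> psdmx A -> psdmx (Phi A).
Proof.
move=> Lp /psdmxP Ap; apply/psdmxP => w.
have wp : psdk (fun p q => w p * (w q)^*).
  apply: eq_psdk (gram_psdk (fun (r : 'I_1) p => w p)) => p q.
  by rewrite big_ord1.
have := psdk_conj_pairing_ge0 (psdkM
  (psdk_comp (fun x : 'I_m * 'I_n => x.1) (psdk_conj Ap))
  (psdk_comp (fun x => x.2) wp)) Lp.
congr (0 <= _).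
rewrite /sform; under [RHS]eq_bigr => p _ do under eq_bigr => q _ do
  rewrite linear_delta summxE mulr_sumr mulr_suml.
transitivity (\sum_i \sum_p \sum_j \sum_q
   (w p)^* * A i j * (Phi (delta_mx i j)) p q * w q).
  rewrite [RHS]pair_big; apply: eq_bigr => -[i p] _; rewrite [RHS]pair_big.
  by apply: eq_bigr => -[j q] _ /=; rewrite !rmorphM /= !conjCK /choik /=; ring.
rewrite exchange_big; apply: eq_bigr => p _.
under eq_bigr => i _ do rewrite exchange_big.
rewrite exchange_big; apply: eq_bigr => q _.
rewrite pair_big; apply: eq_bigr => -[i j] _ /=.
by rewrite mxE; ring.
Qed.

(** Pair the shifted kernel with the tensor product of [A] and the conjugate of [B]: the Gram kernel
    contributes the overlap of the images, and the identity contributes the product of the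
    traces. *)
Lemma gramk_lower m n (Phi : {linear 'M[C]_m -> 'M[C]_n}) lam A B :
  psdk (fun x y => gramk Phi x y - lam * (x == y)%:R) -> psdmx A -> psdmx B ->
  lam * (\tr A * \tr B) <= \tr ((Phi A)^t* *m Phi B).
Proof.
move=> Kp Ap Bp; rewrite -subr_ge0.
have := psdk_conj_pairing_ge0 (psdkM
  (psdk_comp (fun x : 'I_m * 'I_m => x.1) ((psdmxP A).1 Ap))
  (psdk_comp (fun x => x.2) (psdk_conj ((psdmxP B).1 Bp)))) Kp.
congr (0 <= _).
have -> : \sum_(i : 'I_m * 'I_m) \sum_(j : 'I_m * 'I_m)
    (A i.1 j.1 * (B i.2 j.2)^*)^* * (gramk Phi i j - lam * (i == j)%:R) =
  (\sum_(i : 'I_m * 'I_m) \sum_(j : 'I_m * 'I_m)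
      (A i.1 j.1)^* * B i.2 j.2 * gramk Phi i j) -
  lam * \sum_(i : 'I_m * 'I_m) A i.1 i.1 * B i.2 i.2.
  rewrite mulr_sumr -sumrB; apply: eq_bigr => x _.
  rewrite -[X in _ = _ - X](_ : \sum_(y : 'I_m * 'I_m)
     (A x.1 y.1)^* * B x.2 y.2 * (lam * (x == y)%:R) = _).
    by rewrite -sumrB; apply: eq_bigr => y _; rewrite rmorphM /= conjCK; ring.
  rewrite (bigD1 x) //= big1 ?addr0 => [|y /negPf ny]; last first.
    by rewrite eq_sym ny !mulr0.
  by rewrite eqxx mulr1 -(psdk_herm x.1 x.1 ((psdmxP A).1 Ap)); ring.
congr (_ - lam * _); last first.
  rewrite /mxtrace mulr_suml; under [RHS]eq_bigr => ? _ do rewrite mulr_sumr.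
  by rewrite [RHS]pair_big.
rewrite !(linear_delta Phi).
have -> : (\sum_ij A ij.1 ij.2 *: Phi (delta_mx ij.1 ij.2))^t* =
   \sum_ij (A ij.1 ij.2)^* *: (Phi (delta_mx ij.1 ij.2))^t*.
  elim/big_rec2: _ => [|ij x B' _ <-]; first by rewrite trmx0 map_mx0.
  by rewrite linearP map_mxD map_mxZ.
rewrite mulmx_suml linear_sum /=.
under [RHS]eq_bigr => ab _ do rewrite mulmx_sumr linear_sum.
transitivity (\sum_a \sum_i \sum_b \sum_j
  (A a b)^* * B i j * gramk Phi (a, i) (b, j)).
  by rewrite [RHS]pair_big; apply: eq_bigr => -[a i] _; rewrite [RHS]pair_big;
     apply: eq_bigr => -[b j] _.
rewrite -(pair_big xpredT xpredT (fun a b => \sum_ij \tr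
  (((A a b)^* *: (Phi (delta_mx a b))^t*) *m
     (B ij.1 ij.2 *: Phi (delta_mx ij.1 ij.2))))) /=.
apply: eq_bigr => a _; rewrite exchange_big; apply: eq_bigr => b _.
rewrite pair_big; apply: eq_bigr => -[i j] _ /=.
by rewrite -scalemxAl -scalemxAr !mxtraceZ /gramk /= mulrA.
Qed.

(** With G and H the two Gram kernels, G ⊗ H - lam mu 1 = (G - lam 1) ⊗ H + lam 1 ⊗ (H - mu 1), a
    sum of positive kernels; H is positive because [mu] is nonnegative. *)
Lemma gramk_tensop_lower m m' n n' (Phi : 'M[C]_m -> 'M[C]_m')
    (Psi : 'M[C]_n -> 'M[C]_n') lam mu : 0 <= lam -> 0 <= mu ->
  psdk (fun x y => gramk Phi x y - lam * (x == y)%:R) ->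
  psdk (fun x y => gramk Psi x y - mu * (x == y)%:R) ->
  psdk (fun x y => gramk (tensop Phi Psi) x y - lam * mu * (x == y)%:R).
Proof.
move=> l0 m0 Kp Lp.
have Lp' : psdk (gramk Psi).
  have := psdkD Lp (psdkZ m0 (@psdk_id _ _)).
  by apply: eq_psdk => x y /=; rewrite subrK.
pose h1 (x : 'I_(m * n) * 'I_(m * n)) := (tidx1 x.1, tidx1 x.2).
pose h2 (x : 'I_(m * n) * 'I_(m * n)) := (tidx2 x.1, tidx2 x.2).
have := psdkD (psdkM (psdk_comp h1 Kp) (psdk_comp h2 Lp'))
  (psdkZ l0 (psdkM (psdk_comp h1 (@psdk_id _ _)) (psdk_comp h2 Lp))).
apply: eq_psdk => x y.
rewrite gramk_tensop /=.
have -> : (x == y)%:R = (h1 x == h1 y)%:R * (h2 x == h2 y)%:R :> C.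
  rewrite -natrM mulnb; congr (_%:R); case: x y => x1 x2 [y1 y2].
  by rewrite !xpair_eqE !eq_tidx; do 4 case: eqP.
by rewrite /h1 /h2 /=; ring.
Qed.

(** * Tensor powers of a map *)

Section Powers.
Variables (m n : nat) (N : 'M[C]_m -> 'M[C]_n).

Lemma tensop_pow_linear k : linear (tensop_pow N k).
Proof. by case: k => [|k] //=; apply: tensop_linear. Qed.

HB.instance Definition _ k :=
  GRing.isSemilinear.Build _ _ _ _ (tensop_pow N k)
    (GRing.semilinear_linear (@tensop_pow_linear k)).

Lemma tensop_pow_choik k : psdk (choik N) -> psdk (choik (tensop_pow N k)).
Proof.
move=> Np; elim: k => [|k IH] /=.
  apply: eq_psdk (gram_psdk (fun (r : 'I_1) _ => 1)) => -[i p] [j q].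
  by rewrite big_ord1 conjC1 mulr1 /choik mxE !ord1 !eqxx.
pose h1 (x : 'I_(m * tdim m k) * 'I_(n * tdim n k)) := (tidx1 x.1, tidx1 x.2).
pose h2 (x : 'I_(m * tdim m k) * 'I_(n * tdim n k)) := (tidx2 x.1, tidx2 x.2).
have := psdkM (psdk_comp h1 Np) (psdk_comp h2 IH).
apply: eq_psdk => x y.
by rewrite choik_tensop.
Qed.

Lemma tensop_pow_gramk k lam : 0 <= lam ->
  psdk (fun x y => gramk N x y - lam * (x == y)%:R) ->
  psdk (fun x y => gramk (tensop_pow N k) x y - lam ^+ k * (x == y)%:R).
Proof.
move=> l0 Np; elim: k => [|k IH]; last first.
  by rewrite exprS; apply: gramk_tensop_lower; rewrite ?exprn_ge0.
(* For exponent 0 the map is the identity on matrices of size 1, so both kernels equal 1 and the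
   difference is the zero kernel. *)
have := psdkZ (lexx 0) (@psdk_id C ('I_1 * 'I_1)%type).
apply: eq_psdk => -[a i] [b j].
rewrite expr0 !ord1 eqxx mul0r mulr1 /gramk /mxtrace big_ord1 !mxE big_ord1.
by rewrite !mxE !ord1 eqxx conjC1 mulr1 subrr.
Qed.

Lemma tensop_pow_tp k : trace_preserving N -> trace_preserving (tensop_pow N k).
Proof.
move=> tp; have tpd x y : \tr (tensop_pow N k (delta_mx x y)) = (x == y)%:R.
  have trd p (i j : 'I_p) : \tr (delta_mx i j : 'M[C]_p) = (i == j)%:R.
    by rewrite -[delta_mx i j]mulmx1 mxtrace_delta_mul mxE eq_sym.
  elim: k x y => [|k IH] x y /=; first by rewrite trd.
  by rewrite tensop_delta mxtrace_prod tp trd IH -natrM mulnb eq_tidx.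
move=> X; rewrite linear_delta linear_sum /=.
under eq_bigr => ij _ do rewrite linearZ /= tpd.
rewrite -(pair_big xpredT xpredT (fun i j => X i j * (i == j)%:R)) /=.
apply: eq_bigr => i _; rewrite (bigD1 i) //= big1 ?addr0 ?eqxx ?mulr1 // => j.
by rewrite eq_sym => /negPf->; rewrite mulr0.
Qed.

End Powers.
End Channels.

(** * Smallest eigenvalue and kernel of the Choi matrix *)

Section SmallestEigenvalue.
Variable R : realType.
Local Notation C := R[i].

Lemma complex_ge0_Re (z : C) : 0 <= z -> z = (complex.Re z)%:C%C.
Proof. by move=> /ger0_real /RRe_real. Qed.

(** [eigenvalue] refers to row eigenvectors. Row [r] of [U] is one for [d r]; conversely, a nonzero
    coordinate of an eigenvector in the basis of rows of [U] forces its eigenvalue to be the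
    matching [d r]. *)
Lemma eigenvalue_diag n (A U : 'M[C]_n) (d : 'I_n -> C) x : U \is unitarymx ->
  (forall i j, A i j = \sum_r d r * ((U r i)^* * U r j)) ->
  eigenvalue A x <-> exists r, x = d r.
Proof.
move=> Uu AE.
have UA : U *m A = diag_mx (\row_r d r) *m U.
  have -> : A = U^t* *m (diag_mx (\row_r d r) *m U).
    apply/matrixP => i j; rewrite AE mxE; apply: eq_bigr => r _.
    by rewrite mul_diag_mx !mxE; ring.
  by rewrite mulmxA (unitarymxP Uu) mul1mx.
have Uunit := unitarymx_unit Uu.
split=> [/eigenvalueP[v vA v0]|[r ->]]; last first.
  apply/eigenvalueP; exists (row r U); last first.
    apply: contraTneq Uu => r0; apply/negP => /unitarymxP /matrixP /(_ r r).
    rewrite !mxE eqxx big1 => [/eqP|j _]; first by rewrite eq_sym oner_eq0.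
    have := congr1 (fun u : 'rV_n => u 0 j) r0; rewrite !mxE => ->.
    by rewrite mul0r.
  by rewrite -row_mul UA mul_diag_mx; apply/rowP => j; rewrite !mxE.
pose w := v *m U^t*.
have vE : v = w *m U by rewrite /w mulmxKtV.
have w0 : w != 0 by apply: contraNneq v0 => w0; rewrite vE w0 mul0mx.
have wd : w *m diag_mx (\row_r d r) = x *: w.
  rewrite -[LHS](mulmxK Uunit) -(mulmxA w) -UA mulmxA -vE vA -scalemxAl.
  by rewrite invmx_unitary.
have [r wr] := rV0Pn _ w0; clearbody w.
exists r; apply: (mulfI wr); have := congr1 (fun u : 'rV_n => u 0 r) wd.
by rewrite mul_mx_diag !mxE => ->; rewrite mulrC.
Qed.

Section Psd.
Variables (n : nat) (A : 'M[C]_n).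
Hypotheses (n_gt0 : (0 < n)%N) (Ap : psdk (fun i j => A i j)).

Lemma lambda_min_psd : 0 <= lambda_min A /\
  psdk (fun i j => A i j - (lambda_min A)%:C%C * (i == j)%:R).
Proof.
have [U [d [Uu AE dP]]] := psd_spectral Ap.
have eigP x := eigenvalue_diag x Uu AE.
(* The infimum bounds the spectrum from below only once some lower bound is known; 0 is one, and it
   also yields the first claim. *)
have lb0 : lbound [set x : R | eigenvalue A x%:C%C] 0.
  by move=> x /= /eigP[r xr]; have := (dP r).1; rewrite -xr ler0c.
have mem r : [set x : R | eigenvalue A x%:C%C]%classic (complex.Re (d r)).
  by apply/eigP; exists r; rewrite -complex_ge0_Re // (dP r).1.
split; first by apply: lb_le_inf => //; exists (complex.Re (d (Ordinal n_gt0))).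
have le r : 0 <= d r - (lambda_min A)%:C%C.
  rewrite subr_ge0 (complex_ge0_Re (dP r).1) lecR.
  by apply: ge_inf => //; exists 0.
have := wgram_psdk (fun r i => (U r i)^*) le.
apply: eq_psdk => i j; rewrite AE.
have -> : (i == j)%:R = \sum_r (U r i)^* * U r j.
  have /(congr1 (fun M : 'M_n => M i j)) := mulVmx (unitarymx_unit Uu).
  by rewrite invmx_unitary // !mxE => <-; apply: eq_bigr => r _; rewrite !mxE.
by rewrite mulr_sumr -sumrB; apply: eq_bigr => r _; rewrite conjCK; ring.
Qed.

Lemma lambda_min_gt0 :
  (forall v, sform (fun i j => A i j) v v = 0 -> forall i, v i = 0) ->
  0 < lambda_min A.
Proof.
move=> Adef; have [U [d [Uu AE dP]]] := psd_spectral Ap.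
have eigP x := eigenvalue_diag x Uu AE.
(* If [d r] were 0, the form would vanish at the conjugate of row [r] of [U]; definiteness would
   make that row zero, against unitarity. *)
have d_gt0 r : 0 < complex.Re (d r).
  rewrite -ltcR -complex_ge0_Re ?(dP r).1 // lt_def (dP r).1 andbT.
  apply/negP => /eqP dr0; have [_ dE] := dP r.
  have /Adef Ur0 := etrans (esym dE) dr0.
  have /matrixP/(_ r r) := unitarymxP Uu.
  rewrite !mxE eqxx big1 => [/eqP|j _]; first by rewrite eq_sym oner_eq0.
  by rewrite !mxE Ur0 mulr0.
(* Positivity of every eigenvalue does not by itself make the infimum positive; the least of the
   finitely many [d r] is a positive lower bound. *)
pose r0 := Ordinal n_gt0; pose rm := [arg min_(r < r0) complex.Re (d r)]%O.
apply: lt_le_trans (d_gt0 rm) _; apply: lb_le_inf.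
  exists (complex.Re (d r0)); apply/eigP; exists r0.
  by rewrite -complex_ge0_Re // (dP _).1.
move=> x /= /eigP[r xr]; rewrite /rm; case: arg_minP => // s _ /(_ r isT).
by rewrite -xr.
Qed.

End Psd.

Lemma choi_hsadj_tidx m n (Phi : 'M[C]_m -> 'M[C]_n) x y :
  choi (hsadj Phi \o Phi) x y =
    gramk Phi (tidx1 x, tidx2 x) (tidx1 y, tidx2 y).
Proof.
rewrite /choi summxE (bigD1 (tidx2 x)) //= [X in _ + X]big1 ?addr0; last first.
  move=> i /negPf ni; rewrite summxE big1 // => j _.
  by rewrite tprodEx [X in _ * X]mxE eq_sym ni mulr0.
rewrite summxE (bigD1 (tidx2 y)) //= big1 ?addr0; last first.
  move=> j /negPf nj.
  by rewrite tprodEx [X in _ * X]mxE [_ == j]eq_sym nj andbF mulr0.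
by rewrite tprodEx !mxE !eqxx mulr1.
Qed.

(* The vectors [f r] are the vectorised Kraus operators of Phi, up to
   conjugation, and the Gram vectors of [gramk] are the products K_s^* K_r. *)
Lemma gramk_gram m n (Phi : 'M[C]_m -> 'M[C]_n) (J : finType)
    (f : J -> 'I_m * 'I_n -> C) :
  (forall x y, choik Phi x y = \sum_r f r x * (f r y)^*) ->
  let g (rs : J * J) (x : 'I_m * 'I_m) :=
    \sum_p (f rs.2 (x.1, p))^* * f rs.1 (x.2, p) in
  forall x y, gramk Phi x y = \sum_rs g rs x * (g rs y)^*.
Proof.
move=> fE g x y; rewrite /gramk /mxtrace.
transitivity (\sum_q \sum_p \sum_r \sum_s
  ((f s (x.1, p))^* * f r (x.2, p)) * (f s (y.1, q) * (f r (y.2, q))^*)).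
  apply: eq_bigr => q _; rewrite mxE; apply: eq_bigr => p _; rewrite !mxE.
  have := fE (x.1, p) (y.1, q); rewrite /choik /= => ->.
  have := fE (x.2, p) (y.2, q); rewrite /choik /= => ->.
  rewrite rmorph_sum mulr_sumr; apply: eq_bigr => r _.
  by rewrite mulr_suml; apply: eq_bigr => s _; rewrite rmorphM /= conjCK; ring.
under eq_bigr => q _ do rewrite exchange_big.
rewrite exchange_big /=.
under eq_bigr => r _ do under eq_bigr => q _ do rewrite exchange_big.
under eq_bigr => r _ do rewrite exchange_big /=.
rewrite pair_big; apply: eq_bigr => -[r s] _ /=.
rewrite exchange_big mulr_suml; apply: eq_bigr => p _ /=.
rewrite rmorph_sum mulr_sumr; apply: eq_bigr => q _ /=.
by rewrite rmorphM /= conjCK.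
Qed.

Lemma gramk_psdk m n (Phi : 'M[C]_m -> 'M[C]_n) :
  psdk (choik Phi) -> psdk (gramk Phi).
Proof.
case/psdk_gram=> k [f fE].
by apply: eq_psdk (gram_psdk _) => x y; rewrite (gramk_gram fE).
Qed.

Lemma sform_gram_eq0 (I J : finType) (f : J -> I -> C) v :
  sform (fun i j => \sum_r f r i * (f r j)^*) v v = 0 ->
  forall r, \sum_i (v i)^* * f r i = 0.
Proof.
rewrite sform_gram => S0 r; apply/eqP; rewrite -mul_conjC_eq0; apply/eqP.
by apply: (psumr_eq0P _ S0) => // s _; apply: mul_conjC_ge0.
Qed.

(** By the Gram form of [gramk], [v] annihilates every product of an adjoint Kraus operator [s] with
    a Kraus operator [r]. Summing the cases r = s gives the trace relation. Weighting all cases with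
    the outer Kraus entries and summing over r and s reassembles two blocks of the Choi matrix,
    which gives the second relation. *)
Lemma gramk_kernel m n (Phi : 'M[C]_m -> 'M[C]_n) v :
  psdk (choik Phi) -> sform (gramk Phi) v v = 0 ->
  (\sum_a \sum_i (v (a, i))^* * \tr (Phi (delta_mx i a)) = 0) /\
  forall b j, \sum_a \sum_i (v (a, i))^* *:
    (Phi (delta_mx b a) *m Phi (delta_mx i j)) = 0.
Proof.
case/psdk_gram=> k [f fE] v0.
have cE i p j q : Phi (delta_mx i j) p q = \sum_r f r (i, p) * (f r (j, q))^*.
  by rewrite -fE.
have {v0}v0 : sform (fun x y => \sum_rs
    (\sum_p (f rs.2 (x.1, p))^* * f rs.1 (x.2, p)) *
    (\sum_p (f rs.2 (y.1, p))^* * f rs.1 (y.2, p))^*) v v = 0.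
  rewrite -[RHS]v0; apply: eq_bigr => x _; apply: eq_bigr => y _.
  by rewrite (gramk_gram fE).
have {}v0 r s :
    \sum_a \sum_i (v (a, i))^* * \sum_p (f s (a, p))^* * f r (i, p) = 0.
  rewrite -[RHS](sform_gram_eq0 v0 (r, s)) pair_big.
  by apply: eq_bigr => -[a i] _.
split.
  transitivity (\sum_r \sum_a \sum_i
      (v (a, i))^* * \sum_p (f r (a, p))^* * f r (i, p)); last exact: big1.
  rewrite [RHS]exchange_big; apply: eq_bigr => a _ /=.
  rewrite [RHS]exchange_big; apply: eq_bigr => i _ /=.
  rewrite -mulr_sumr exchange_big; congr (_ * _); apply: eq_bigr => p _ /=.
  by rewrite cE; apply: eq_bigr => r _; rewrite mulrC.
move=> b j; apply/matrixP => q q'; rewrite summxE mxE.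
transitivity (\sum_s \sum_r f s (b, q) * (f r (j, q'))^* *
   \sum_a \sum_i (v (a, i))^* * \sum_p (f s (a, p))^* * f r (i, p)); last first.
  by rewrite big1 // => s _; rewrite big1 // => r _; rewrite v0 mulr0.
under [RHS]eq_bigr => s _ do under eq_bigr => r _ do rewrite mulr_sumr.
under [RHS]eq_bigr => s _ do rewrite exchange_big.
rewrite [RHS]exchange_big; apply: eq_bigr => a _ /=; rewrite summxE.
under [RHS]eq_bigr => s _ do under eq_bigr => r _ do rewrite mulr_sumr.
under [RHS]eq_bigr => s _ do rewrite exchange_big.
rewrite [RHS]exchange_big; apply: eq_bigr => i _ /=; rewrite !mxE mulr_sumr.
under [RHS]eq_bigr => s _ do under eq_bigr => r _ do
  rewrite mulrCA mulr_sumr mulr_sumr.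
under [RHS]eq_bigr => s _ do rewrite exchange_big.
rewrite [RHS]exchange_big; apply: eq_bigr => p _ /=.
rewrite !cE mulr_suml mulr_sumr; apply: eq_bigr => s _.
by rewrite !mulr_sumr; apply: eq_bigr => r _; ring.
Qed.

End SmallestEigenvalue.

(** * Qubit channels *)

Lemma sum_ord2 (V : nmodType) (F : 'I_2 -> V) : \sum_i F i = F 0 + F 1.
Proof.
rewrite big_ord_recl big_ord1; congr (_ + F _); exact: val_inj.
Qed.

Lemma sum_eqZ (F : nzRingType) (V : lmodType F) (I : finType) (G : I -> V) b :
  \sum_a (b == a)%:R *: G a = G b.
Proof.
rewrite (bigD1 b) //= eqxx scale1r big1 ?addr0 // => a /negPf ab.
by rewrite eq_sym ab scale0r.
Qed.

(* With matrices: V^T W + W V^T is scalar for traceless V, W of size 2. *)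
Lemma traceless_mx2_pairing (F : comNzRingType) (V W : 'I_2 -> 'I_2 -> F) :
  V 1 1 = - V 0 0 -> W 1 1 = - W 0 0 ->
  \sum_b \sum_j \sum_a \sum_i (W b j * V a i) *:
    ((b == a)%:R *: delta_mx i j + (i == j)%:R *: delta_mx b a) =
  (2 * (V 0 0 * W 0 0) + V 0 1 * W 0 1 + V 1 0 * W 1 0)%:M :> 'M[F]_2.
Proof.
move=> V11 W11.
transitivity (\sum_i \sum_j (\sum_b W b j * V b i) *: (delta_mx i j : 'M[F]_2) +
   \sum_b \sum_a (\sum_j W b j * V a j) *: (delta_mx b a : 'M[F]_2)).
  transitivity (\sum_b \sum_j (\sum_a (b == a)%:R *:
        \sum_i (W b j * V a i) *: (delta_mx i j : 'M[F]_2)) +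
      \sum_b \sum_j \sum_a (\sum_i (j == i)%:R *:
        ((W b j * V a i) *: (delta_mx b a : 'M[F]_2)))).
    rewrite -big_split; apply: eq_bigr => b _; rewrite -big_split.
    apply: eq_bigr => j _; rewrite -big_split; apply: eq_bigr => a _.
    rewrite scaler_sumr -big_split; apply: eq_bigr => i _ /=.
    by rewrite scalerDr !scalerA ![_ * _%:R]mulrC [i == j]eq_sym.
  congr (_ + _).
    under eq_bigr => b _ do under eq_bigr => j _ do rewrite sum_eqZ.
    under eq_bigr => b _ do rewrite exchange_big.
    rewrite exchange_big; apply: eq_bigr => i _; rewrite exchange_big.
    by apply: eq_bigr => j _; rewrite scaler_suml.
  apply: eq_bigr => b _; rewrite exchange_big; apply: eq_bigr => a _.
  by rewrite scaler_suml; apply: eq_bigr => j _; rewrite sum_eqZ.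
pose S : 'M[F]_2 := \matrix_(i, j) \sum_b W b j * V b i.
pose T : 'M[F]_2 := \matrix_(b, a) \sum_j W b j * V a j.
transitivity (S + T).
  rewrite (matrix_sum_delta S) (matrix_sum_delta T).
  by congr (_ + _); apply: eq_bigr => i _; apply: eq_bigr => j _; rewrite mxE.
apply/matrixP => x y; rewrite !mxE !sum_ord2.
have: (x == 0) || (x == 1) by case: x => -[|[|]].
have: (y == 0) || (y == 1) by case: y => -[|[|]].
by case/orP=> /eqP->; case/orP=> /eqP->;
  rewrite ?V11 ?W11 /= ?mulr1n ?mulr0n; ring.
Qed.

Section QubitKernel.
Variable R : realType.
Local Notation C := R[i].

(** The polarised Cayley-Hamilton identity in dimension 2. *)
Lemma mx2_anticommutator (X Y : 'M[C]_2) : X *m Y + Y *m X =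
  \tr X *: Y + \tr Y *: X + (\tr (X *m Y) - \tr X * \tr Y)%:M.
Proof.
apply/matrixP => i j; rewrite !mxE /mxtrace !sum_ord2 !mxE !sum_ord2.
have: (i == 0) || (i == 1) by case: i => -[|[|]].
have: (j == 0) || (j == 1) by case: j => -[|[|]].
by case/orP=> /eqP->; case/orP=> /eqP->; rewrite /= ?mulr1n ?mulr0n; ring.
Qed.

Lemma unital_of_gramk_kernel (N : {linear 'M[C]_2 -> 'M[C]_2}) v :
  psdk (choik N) -> trace_preserving N ->
  sform (gramk N) v v = 0 -> (exists x, v x != 0) -> N 1%:M = 1%:M.
Proof.
move=> Np tp v0 [x vx].
have [tr0 E] := gramk_kernel Np v0.
pose V a i := (v (a, i))^*; pose M i j := N (delta_mx i j).
have trM i j : \tr (M i j) = (i == j)%:R.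
  by rewrite /M tp -[delta_mx i j]mulmx1 mxtrace_delta_mul mxE eq_sym.
have Mt i j : (M i j)^t* = M j i.
  apply/matrixP => p q; rewrite !mxE.
  by have := psdk_herm (i, q) (j, p) Np; rewrite /choik /=.
(* Since [N] preserves the trace, the trace relation of [gramk_kernel] says that [V] is
   traceless. *)
have V0 : V 1 1 = - V 0 0.
  move: tr0; rewrite !sum_ord2 !trM /= !mulr1 !mulr0 addr0 add0r => /eqP.
  by rewrite addrC addr_eq0 => /eqP.
have {}E b j : \sum_a \sum_i V a i *: (M b a *m M i j) = 0 by apply: E.
have ME i j : M i j = N (delta_mx i j) by [].
clearbody M.
(* The conjugate transpose of [E], as [M i j] and [M j i] are adjoint to each other. *)
have F i a : \sum_b \sum_j (V b j)^* *: (M i j *m M b a) = 0.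
  apply/matrixP => p q; have := congr1 (fun X : 'M[C]_2 => (X q p)^*) (E a i).
  rewrite [in RHS]mxE conjC0 => tE; rewrite [RHS]mxE -[RHS]tE.
  rewrite !summxE rmorph_sum; apply: eq_bigr => b _ /=.
  rewrite !summxE rmorph_sum; apply: eq_bigr => j _ /=.
  rewrite !mxE rmorphM /= rmorph_sum; congr (_ * _); apply: eq_bigr => t _.
  by rewrite rmorphM /= -(Mt a b) -(Mt j i) !mxE mulrC.
pose coef b j a i := (V b j)^* * V a i.
(* The products in one order cancel in the sum over a and i by [E], those in the other order in the
   sum over b and j by [F]. *)
have S0 : \sum_b \sum_j \sum_a \sum_i
    coef b j a i *: (M b a *m M i j + M i j *m M b a) = 0.
  under eq_bigr => b _ do under eq_bigr => j _ do under eq_bigr => a _ do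
    under eq_bigr => i _ do rewrite scalerDr.
  under eq_bigr => b _ do under eq_bigr => j _ do under eq_bigr => a _ do
    rewrite big_split.
  under eq_bigr => b _ do under eq_bigr => j _ do rewrite big_split.
  under eq_bigr => b _ do rewrite big_split.
  rewrite big_split /= [X in X + _]big1 ?add0r => [|b _]; last first.
    rewrite big1 // => j _.
    transitivity ((V b j)^* *: (\sum_a \sum_i V a i *: (M b a *m M i j)));
      last by rewrite E scaler0.
    rewrite scaler_sumr; apply: eq_bigr => a _; rewrite scaler_sumr.
    by apply: eq_bigr => i _; rewrite scalerA.
  rewrite pair_big; under eq_bigr => bj _ do rewrite pair_big.
  rewrite exchange_big big1 // => -[a i] _ /=.
  transitivity (V a i *: (\sum_b \sum_j (V b j)^* *: (M i j *m M b a)));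
    last by rewrite F scaler0.
  rewrite pair_big scaler_sumr.
  by apply: eq_bigr => -[b j] _; rewrite scalerA /coef mulrC.
(* In the anticommutator formula the scalar terms of [S0] add up to [s], and the linear terms add up
   to [N Z] because the trace of [M i j] is 1 or 0. *)
pose s := \sum_b \sum_j \sum_a \sum_i coef b j a i *
  (\tr (M b a *m M i j) - (b == a)%:R * (i == j)%:R).
pose Z : 'M[C]_2 := \sum_b \sum_j \sum_a \sum_i coef b j a i *:
  ((b == a)%:R *: delta_mx i j + (i == j)%:R *: delta_mx b a).
have NZ : N Z = - s%:M.
  apply/eqP; rewrite -addr_eq0; apply/eqP; rewrite -[RHS]S0 /s.
  rewrite rmorph_sum linear_sum -big_split.
  apply: eq_bigr => b _ /=.
  rewrite rmorph_sum linear_sum -big_split; apply: eq_bigr => j _ /=.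
  rewrite rmorph_sum linear_sum -big_split; apply: eq_bigr => a _ /=.
  rewrite rmorph_sum linear_sum -big_split; apply: eq_bigr => i _ /=.
  rewrite mx2_anticommutator !trM linearZ linearD !linearZ /= -!ME.
  by rewrite [RHS]scalerDr scale_scalar_mx.
(* As [V] is traceless, [c] is its squared Hilbert-Schmidt norm, hence nonzero. *)
pose c := 2 * (V 0 0 * (V 0 0)^* ) + V 0 1 * (V 0 1)^* + V 1 0 * (V 1 0)^*.
have Zc : Z = c%:M.
  by apply: (traceless_mx2_pairing (W := fun b j => (V b j)^*)) => //;
     rewrite V0 rmorphN.
have c0 : c != 0.
  have VV a i : 0 <= V a i * (V a i)^* by apply: mul_conjC_ge0.
  have VV2 : 0 <= 2 * (V 0 0 * (V 0 0)^*) by rewrite mulr_ge0.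
  apply/negP; rewrite /c paddr_eq0 ?addr_ge0 // paddr_eq0 //.
  rewrite mulf_eq0 pnatr_eq0 /= !mul_conjC_eq0 => /andP[/andP[p0 q0] r0].
  case/negP: vx; rewrite -conjC_eq0; case: x => a i; rewrite -/(V a i).
  have: (i == 0) || (i == 1) by case: i => -[|[|]].
  have: (a == 0) || (a == 1) by case: a => -[|[|]].
  by case/orP=> /eqP->; case/orP=> /eqP->; rewrite ?V0 ?oppr_eq0.
have N1 : N 1%:M = (- s / c)%:M.
  apply: (scalerI c0); rewrite scale_scalar_mx mulrC mulfVK // -linearZ.
  by rewrite scalemx1 -Zc NZ raddfN.
(* [N 1%:M] is now known to be scalar; comparing traces fixes the scalar as 1. *)
have := tp 1%:M; rewrite N1 !mxtrace_scalar; clearbody s c.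
by move/eqP; rewrite eqrMn2r /= => /eqP->.
Qed.

End QubitKernel.

(** * Hockey-stick divergence *)

Section Weights.
Variable C : numClosedFieldType.

(** Lagrange's identity: twice the gap between the two sides is a double sum of squared moduli. *)
Lemma sum_CauchySchwarz (I : finType) (P : pred I) (f g : I -> C) :
  (\sum_(i | P i) (f i)^* * g i) * (\sum_(i | P i) (f i)^* * g i)^* <=
  (\sum_(i | P i) f i * (f i)^*) * (\sum_(i | P i) g i * (g i)^*).
Proof.
set L := (X in X <= _); set M := (X in _ <= X).
suff e : \sum_(i | P i) \sum_(j | P j) (f i * g j - f j * g i) *
      (f i * g j - f j * g i)^* = 2 * (M - L).
  rewrite -subr_ge0 -(pmulr_rge0 _ (ltr0n C 2)) -e.
  by apply: sumr_ge0 => i _; apply: sumr_ge0 => j _; apply: mul_conjC_ge0.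
have -> : 2 * (M - L) = (M - L) + (M - L) by ring.
have ME : M - L = \sum_(i | P i) \sum_(j | P j)
    ((f i * (f i)^*) * (g j * (g j)^*) - (f j)^* * g j * (f i * (g i)^*)).
  transitivity (
     \sum_(i | P i) \sum_(j | P j) (f i * (f i)^*) * (g j * (g j)^*) -
     \sum_(i | P i) \sum_(j | P j) (f j)^* * g j * (f i * (g i)^*)); last first.
    by rewrite -sumrB; apply: eq_bigr => i _; rewrite -sumrB.
  congr (_ - _).
    by rewrite /M mulr_suml; apply: eq_bigr => i _; rewrite mulr_sumr.
  rewrite /L mulr_suml exchange_big; apply: eq_bigr => i _ /=.
  rewrite rmorph_sum mulr_sumr; apply: eq_bigr => j _.
  by rewrite rmorphM /= conjCK.
rewrite {1}ME {}ME [X in _ = X + _]exchange_big -big_split.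
apply: eq_bigr => i _ /=.
rewrite -big_split; apply: eq_bigr => j _ /=.
by rewrite rmorphB !rmorphM /=; ring.
Qed.

Lemma sqnormD_le (x y : C) :
  (x + y) * (x + y)^* <= 2 * (x * x^*) + 2 * (y * y^*).
Proof.
rewrite -subr_ge0.
have -> : 2 * (x * x^*) + 2 * (y * y^*) - (x + y) * (x + y)^* =
    (x - y) * (x - y)^* by rewrite rmorphB rmorphD /=; ring.
exact: mul_conjC_ge0.
Qed.

(* A weak form, with a factor 2, of the Fuchs-van de Graaf fidelity bound for
   the two-outcome measurement {P, 1 - P}. *)
Lemma psd_overlap_diag n (A B : 'M[C]_n) (P : pred 'I_n) :
  psdk (fun i j => A i j) -> psdk (fun i j => B i j) ->
  \tr (A *m B) <= 2 * ((\sum_(i | P i) A i i) * (\sum_(i | P i) B i i)) +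
    2 * ((\sum_(i | ~~ P i) A i i) * (\sum_(i | ~~ P i) B i i)).
Proof.
case/psdk_gram=> p [f fE] /psdk_gram[q [g gE]].
have weight (D : pred 'I_n) : (\sum_(i | D i) A i i) * (\sum_(i | D i) B i i) =
    \sum_r \sum_s (\sum_(i | D i) f r i * (f r i)^*) *
      (\sum_(i | D i) g s i * (g s i)^*).
  rewrite (eq_bigr _ (fun i _ => fE i i)) (eq_bigr _ (fun i _ => gE i i)).
  rewrite exchange_big [X in _ * X]exchange_big mulr_suml.
  by apply: eq_bigr => r _; rewrite mulr_sumr.
have -> : \tr (A *m B) = \sum_r \sum_s
    (\sum_i (f r i)^* * g s i) * (\sum_i (f r i)^* * g s i)^*.
  transitivity (\sum_i \sum_j \sum_r \sum_s
      ((f r j)^* * g s j) * (f r i * (g s i)^*)).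
    apply: eq_bigr => i _; rewrite mxE; apply: eq_bigr => j _.
    rewrite fE gE mulr_suml; apply: eq_bigr => r _; rewrite mulr_sumr.
    by apply: eq_bigr => s _; ring.
  under eq_bigr => i _ do rewrite exchange_big.
  rewrite exchange_big; apply: eq_bigr => r _ /=.
  under eq_bigr => i _ do rewrite exchange_big.
  rewrite exchange_big; apply: eq_bigr => s _ /=.
  rewrite exchange_big mulr_suml; apply: eq_bigr => j _ /=.
  rewrite rmorph_sum mulr_sumr; apply: eq_bigr => i _.
  by rewrite rmorphM /= conjCK.
rewrite !weight !mulr_sumr -big_split; apply: ler_sum => r _ /=.
rewrite !mulr_sumr -big_split; apply: ler_sum => s _ /=.
(* Each inner product of Gram vectors is split over [P] and its complement. The factor 2 comes from
   [sqnormD_le], and Cauchy-Schwarz bounds each half. *)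
rewrite (bigID P) /=; apply: le_trans (sqnormD_le _ _) _.
by rewrite lerD // ler_pM2l ?ltr0n // sum_CauchySchwarz.
Qed.

End Weights.

(** * Measurement weights, the positive part and the scalar inequality *)

Section HockeyStick.
Variable R : realType.
Local Notation C := R[i].

Lemma psdmx_congr m n (U : 'M[C]_(m, n)) A : psdmx A -> psdmx (U *m A *m U^t*).
Proof.
move=> Ap v; have := Ap (U^t* *m v); congr (0 <= (_ : 'M__) _ _).
by rewrite trmx_mul map_mxM trmxCK !mulmxA.
Qed.

Lemma psdmx_diag n (d : 'rV[C]_n) : (forall i, 0 <= d 0 i) -> psdmx (diag_mx d).
Proof.
move=> d0 v; rewrite mul_mx_diag mxE; apply: sumr_ge0 => i _; rewrite !mxE.
by rewrite mulrAC mulr_ge0 // mulrC mul_conjC_ge0.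
Qed.

Lemma psd_diag_ge0 n (A : 'M[C]_n) i : psdmx A -> 0 <= A i i.
Proof.
by move/psdmxP => Ap; rewrite -(sform_delta (fun i j => A i j)); apply: Ap.
Qed.

Lemma psdmxZ n (A : 'M[C]_n) c : 0 <= c -> psdmx A -> psdmx (c *: A).
Proof.
move=> c0 Ap v; rewrite -scalemxAr -scalemxAl mxE; apply: mulr_ge0 => //.
Qed.

(** For unitary [U], the trace of [A] against the projector onto the span of the conjugate
    transposes of the rows of [U] selected by [P]. *)
Definition weight n (U : 'M[C]_n) (P : pred 'I_n) (A : 'M[C]_n) : C :=
  \sum_(i | P i) (U *m A *m U^t*) i i.

Lemma weightB n (U : 'M[C]_n) P c A d B :
  weight U P (c *: A - d *: B) = c * weight U P A - d * weight U P B.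
Proof.
rewrite /weight !mulr_sumr -sumrB; apply: eq_bigr => i _.
by rewrite mulmxBr mulmxBl -!scalemxAr -!scalemxAl !mxE.
Qed.

Lemma weightT n (U : 'M[C]_n) A : U \is unitarymx -> weight U predT A = \tr A.
Proof.
move=> Uu; rewrite -[LHS]/(\tr (U *m A *m U^t*)) mxtrace_mulC mulmxA.
by rewrite -invmx_unitary // mulVmx ?mul1mx // unitarymx_unit.
Qed.

Lemma weight_ge0 n (U : 'M[C]_n) P A : psdmx A -> 0 <= weight U P A.
Proof.
by move=> Ap; apply: sumr_ge0 => i _; apply: psd_diag_ge0; apply: psdmx_congr.
Qed.

Lemma weightC n (U : 'M[C]_n) P A : U \is unitarymx ->
  weight U (predC P) A = \tr A - weight U P A.
Proof.
move=> Uu; rewrite -(weightT A Uu).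
have -> : weight U predT A = weight U P A + weight U (predC P) A.
  by rewrite /weight (bigID P).
by rewrite addrAC subrr add0r.
Qed.

Lemma weight_le_trace n (U : 'M[C]_n) P A : U \is unitarymx -> psdmx A ->
  weight U P A <= \tr A.
Proof. by move=> Uu Ap; rewrite -subr_ge0 -weightC // weight_ge0. Qed.

Lemma psd_overlap n (U : 'M[C]_n) P A B : U \is unitarymx ->
  psdmx A -> psdmx B -> \tr A = 1 -> \tr B = 1 ->
  \tr (A *m B) <= 2 * (weight U P A * weight U P B) +
    2 * ((1 - weight U P A) * (1 - weight U P B)).
Proof.
move=> Uu Ap Bp A1 B1.
have UV : U^t* *m U = 1%:M.
  by rewrite -invmx_unitary // mulVmx // unitarymx_unit.
have -> : \tr (A *m B) = \tr ((U *m A *m U^t*) *m (U *m B *m U^t*)).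
  rewrite -(weightT (A *m B) Uu) -[LHS]/(\tr (U *m (A *m B) *m U^t*)).
  by rewrite -!mulmxA (mulmxA (U^t*)) UV mul1mx.
have wC D : \tr D = 1 -> 1 - weight U P D = weight U (predC P) D.
  by move=> <-; rewrite weightC.
rewrite !wC //.
by apply: psd_overlap_diag; apply/psdmxP; apply: psdmx_congr.
Qed.

Section PositivePart.
Variables (n : nat) (X : 'M[C]_n).
Hypothesis Xh : X^t* = X.
Let U := spectralmx X.
Let d := spectral_diag X.

Let Uu : U \is unitarymx. Proof. exact: spectral_unitarymx. Qed.
Let XE : X = U^t* *m diag_mx d *m U. Proof. by case: (herm_spectral Xh). Qed.
Let d_real r : d 0 r \is Num.real.
Proof. by case: (herm_spectral Xh) => _ _ /(_ r)[]. Qed.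
Let dE r : d 0 r = (U *m X *m U^t*) r r.
Proof. by case: (herm_spectral Xh) => _ _ /(_ r)[]. Qed.

Lemma pospartE : pospart X = U^t* *m diag_mx (map_mx (Num.max 0) d) *m U.
Proof. by rewrite /pospart -/U -/d invmx_unitary. Qed.

Lemma pospart_psd : psdmx (pospart X).
Proof.
rewrite pospartE -{2}(trmxCK U); apply: psdmx_congr; apply: psdmx_diag => i.
(* The order on [R[i]] is partial; the maximum with 0 behaves as expected because the eigenvalues
   are real. *)
by rewrite mxE comparable_le_max ?lexx // real_comparable.
Qed.

Lemma negpart_psd : psdmx (pospart X - X).
Proof.
have -> : pospart X - X =
    U^t* *m diag_mx (map_mx (Num.max 0) d - d) *m (U^t*)^t*.
  by rewrite pospartE {1}XE trmxCK linearB /= mulmxBr mulmxBl.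
apply: psdmx_congr; apply: psdmx_diag => i.
by rewrite !mxE subr_ge0 comparable_le_max ?lexx ?orbT // real_comparable.
Qed.

(** Take the eigenbasis of [X] and its positive eigenvalues. The trace of the positive part becomes
    an expression linear in its last argument, so it can be evaluated on any other decomposition of
    [X]. *)
Lemma tr_pospart : exists (V : 'M[C]_n) (P : pred 'I_n),
  V \is unitarymx /\ \tr (pospart X) = weight V P X.
Proof.
exists U, (fun r => 0 < d 0 r); split=> //.
rewrite pospartE mxtrace_mulC mulmxA (unitarymxP Uu) mul1mx mxtrace_diag.
rewrite /weight [RHS]big_mkcond; apply: eq_bigr => r _; rewrite mxE -dE.
by rewrite /Order.max.
Qed.

End PositivePart.

Lemma hockey_stick_bound (gamma e q a b mu : R) : 1 <= gamma ->
  0 < e -> e <= 1 -> q = e + gamma - 1 -> 0 <= a <= 1 -> 0 <= b <= 1 ->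
  2 * mu <= a * b + (1 - a) * (1 - b) ->
  (e * a - q * b) / e <=
    2^-1 * Num.sqrt ((1 + gamma) ^+ 2 - 4 * gamma * mu) + (1 - gamma) / 2.
Proof.
move=> g1 e0 e1 -> /andP[a0 a1] /andP[b0 b1] mu_le.
(* Here [q] is at least [gamma * e], because [gamma] is at least 1 and [e] at most 1. *)
apply: (@le_trans _ _ (a - gamma * b)).
  rewrite ler_pdivrMr //.
  have : 0 <= (gamma - 1) * (1 - e) * b by rewrite !mulr_ge0 ?subr_ge0.
  by lra.
pose z := 2 * (a - gamma * b) - (1 - gamma).
suff : z <= Num.sqrt ((1 + gamma) ^+ 2 - 4 * gamma * mu) by rewrite /z; lra.
apply: le_trans (ler_norm _) _; rewrite -sqrtr_sqr ler_wsqrtr //.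
(* The difference between the radicand and the square of [z] is exactly four times the quantities in
   [h1] and [h2] plus twice those in [h3] and [h4]. *)
have h1 : 0 <= a * (1 - a) by rewrite mulr_ge0 ?subr_ge0.
have h2 : 0 <= gamma ^+ 2 * (b * (1 - b)).
  by rewrite mulr_ge0 ?sqr_ge0 // mulr_ge0 ?subr_ge0.
have h3 : 0 <= gamma * (a * b + (1 - a) * (1 - b) - 2 * mu).
  by rewrite mulr_ge0 ?subr_ge0 //; lra.
have h4 : 0 <= gamma * (a * b + (1 - a) * (1 - b)).
  by rewrite mulr_ge0 ?addr_ge0 ?mulr_ge0 ?subr_ge0 //; lra.
by rewrite /z; nra.
Qed.

End HockeyStick.

(** * Contraction of the hockey-stick divergence under a positive map with bounded Gram kernel *)

Section Contraction.
Variable R : realType.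
Local Notation C := R[i].

Lemma psd_trace_ge0 n (A : 'M[C]_n) : psdmx A -> 0 <= \tr A.
Proof. by move=> Ap; apply: sumr_ge0 => i _; apply: psd_diag_ge0. Qed.

Lemma herm_subZ n (gamma : R) (A B : 'M[C]_n) : psdmx A -> psdmx B ->
  (A - gamma%:C%C *: B)^t* = A - gamma%:C%C *: B.
Proof.
move=> /psdmxP Ap /psdmxP Bp.
have gR : (gamma%:C%C : C)^* = gamma%:C%C by apply/CrealP; rewrite complex_real.
apply/matrixP => i j; rewrite !mxE rmorphB rmorphM /= gR.
by rewrite -(psdk_herm j i Ap) -(psdk_herm j i Bp).
Qed.

Lemma hockey_stick_le1 n (gamma : R) (rho sigma : 'M[C]_n) : 0 <= gamma ->
  qstate rho -> qstate sigma -> hockey_stick gamma rho sigma <= 1.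
Proof.
move=> g0 [rp r1] [sp s1]; rewrite /hockey_stick.
have [V [P [Vu ->]]] := tr_pospart (herm_subZ gamma rp sp).
rewrite -[rho]scale1r weightB mul1r -lecR RRe_real; last first.
  by rewrite rpredB ?rpredM ?ger0_real ?weight_ge0 ?ler0c.
apply: (@le_trans _ _ (weight V P rho)); last first.
  by rewrite rmorph1 -r1 weight_le_trace.
by rewrite gerBl mulr_ge0 ?weight_ge0 ?ler0c.
Qed.

Lemma complex_unit_interval (z : C) : 0 <= z -> z <= 1 ->
  exists2 a : R, z = a%:C%C & 0 <= a <= 1.
Proof.
move=> z0 z1; exists (complex.Re z); first exact: complex_ge0_Re.
by move: z0 z1; rewrite !lecE /= => /andP[_ ->] /andP[_ ->].
Qed.

Lemma weight_real n (U : 'M[C]_n) P A : U \is unitarymx -> psdmx A ->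
  \tr A = 1 -> exists2 a : R, weight U P A = a%:C%C & 0 <= a <= 1.
Proof.
move=> Uu Ap A1; apply: complex_unit_interval; first exact: weight_ge0.
by apply: le_trans (weight_le_trace P Uu Ap) _; rewrite A1.
Qed.

Lemma hockey_stick_contraction m n (T : {linear 'M[C]_m -> 'M[C]_n})
    (gamma lam mu : R) (rho sigma : 'M[C]_m) :
  1 <= gamma -> psdk (choik T) -> trace_preserving T ->
  psdk (fun x y => gramk T x y - lam%:C%C * (x == y)%:R) -> 4 * mu <= lam ->
  qstate rho -> qstate sigma -> 0 < hockey_stick gamma rho sigma ->
  hockey_stick gamma (T rho) (T sigma) / hockey_stick gamma rho sigma <=
    2^-1 * Num.sqrt ((1 + gamma) ^+ 2 - 4 * gamma * mu) + (1 - gamma) / 2.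
Proof.
move=> g1 Tp tp Tlam mu_le rq sq.
have [[rp r1] [sp s1]] := (rq, sq).
have g0 : 0 <= gamma by apply: le_trans g1.
have e1 := hockey_stick_le1 g0 rq sq.
set e := hockey_stick gamma rho sigma in e1 * => e0.
pose X := rho - gamma%:C%C *: sigma.
have Xh : X^t* = X by apply: herm_subZ.
have Pp := pospart_psd Xh; have Qp := negpart_psd Xh.
set P := pospart X in Pp Qp; set Q := P - X in Qp.
(* The trace of [Q]: [P] has trace [e] and [X] has trace 1 - gamma. *)
pose q := e + gamma - 1.
have q0 : 0 < q by rewrite /q -addrA ltr_wpDr ?subr_ge0.
have trP : \tr P = e%:C%C by rewrite [LHS](complex_ge0_Re (psd_trace_ge0 Pp)).
have trQ : \tr Q = q%:C%C.
  rewrite linearB /= trP /X linearB linearZ /= r1 s1 mulr1 /q rmorphB rmorphD.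
  by rewrite /= rmorph1; ring.
have eC : e%:C%C != 0 by rewrite fmorph_eq0 gt_eqF.
have qC : q%:C%C != 0 by rewrite fmorph_eq0 gt_eqF.
pose P' := e%:C%C^-1 *: P; pose Q' := q%:C%C^-1 *: Q.
have P'p : psdmx P' by apply: psdmxZ; rewrite // invr_ge0 ler0c ltW.
have Q'p : psdmx Q' by apply: psdmxZ; rewrite // invr_ge0 ler0c ltW.
have P'1 : \tr P' = 1 by rewrite mxtraceZ trP mulVf.
have Q'1 : \tr Q' = 1 by rewrite mxtraceZ trQ mulVf.
have XE : X = e%:C%C *: P' - q%:C%C *: Q'.
  by rewrite /P' /Q' !scalerA !mulfV // !scale1r /Q opprB addrC subrK.
clearbody P' Q'.
have TPp := choik_positive Tp P'p; have TQp := choik_positive Tp Q'p.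
have TP1 : \tr (T P') = 1 := etrans (tp P') P'1.
have TQ1 : \tr (T Q') = 1 := etrans (tp Q') Q'1.
have YE : T rho - gamma%:C%C *: T sigma = e%:C%C *: T P' - q%:C%C *: T Q'.
  transitivity (T X); first by rewrite /X linearB [T (_ *: _)]linearZ.
  by rewrite XE linearB ![T (_ *: _)]linearZ.
have Yh := herm_subZ gamma (choik_positive Tp rp) (choik_positive Tp sp).
rewrite /hockey_stick.
have [V [S [Vu ->]]] := tr_pospart Yh.
rewrite YE weightB.
have lam_le := gramk_lower Tlam P'p Q'p.
rewrite P'1 Q'1 mulr1 mulr1 (psd_trmxC TPp) in lam_le.
have := le_trans lam_le (psd_overlap S Vu TPp TQp TP1 TQ1).
have [a -> a01] := weight_real S Vu TPp TP1.
have [b -> b01] := weight_real S Vu TQp TQ1.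
have -> : 2 * (a%:C%C * b%:C%C) + 2 * ((1 - a%:C%C) * (1 - b%:C%C)) =
    (2 * (a * b) + 2 * ((1 - a) * (1 - b)))%:C%C.
  rewrite [RHS]rmorphD [X in _ = X + _]rmorphM [X in _ = _ + X]rmorphM.
  rewrite [X in _ = X * _ + X * _]rmorph_nat.
  rewrite [X in _ = _ * X + _]rmorphM [X in _ = _ + _ * X]rmorphM.
  rewrite [X in _ = _ + _ * (X * _)]rmorphB [X in _ = _ + _ * (_ * X)]rmorphB.
  by rewrite [X in _ = _ + _ * ((X - _) * (X - _))]rmorph1.
have -> : e%:C%C * a%:C%C - q%:C%C * b%:C%C = (e * a - q * b)%:C%C.
  by rewrite [RHS]rmorphB [X in _ = X - _]rmorphM [X in _ = _ - X]rmorphM.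
rewrite lecR => lam_ab.
(* The two overlap bounds give lam <= 2 (a b + (1 - a) (1 - b)); with 4 mu <= lam this is the
   hypothesis on [mu]. *)
by apply: (hockey_stick_bound g1 e0 e1 (erefl q) a01 b01); lra.
Qed.

(** One factor 1/4 cancels the 4 and the others only decrease the power. At exponent 0 the sides
    would be 4 and 1. *)
Lemma quarter_expr_le (lam : R) k : (0 < k)%N -> 0 <= lam ->
  4 * (lam / 4) ^+ k <= lam ^+ k.
Proof.
case: k => // k _ lam0; rewrite exprS mulrA [4 * _]mulrC divfK ?pnatr_eq0 //.
rewrite exprS ler_wpM2l // lerXn2r ?nnegrE ?divr_ge0 //.
by rewrite ler_pdivrMr // ler_peMr // ler1n.
Qed.

End Contraction.

Theorem mainTheorem8 (R : realType) (gamma : R) (k : nat)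
    (N : {linear 'M[R[i]]_2 -> 'M[R[i]]_2})
    (hgamma : 1 <= gamma) (hk : (1 <= k)%N) (hN : qchannel N) :
  (contraction_coeff gamma (tensop_pow N k) <=
    (2^-1 * Num.sqrt ((1 + gamma) ^+ 2
        - 4 * gamma * (lambda_min (choi (hsadj N \o N)) / 4) ^+ k)
      + (1 - gamma) / 2)%:E)%E
  /\ (N 1%:M <> 1%:M -> 0 < lambda_min (choi (hsadj N \o N))).
Proof.
have [cp tp] := hN; have Lp := cp_choik cp; have Kp := gramk_psdk Lp.
set A := choi (hsadj N \o N); set lam := lambda_min A.
have AE x y : A (tidx x.1 x.2) (tidx y.1 y.2) = gramk N x y.
  by rewrite /A choi_hsadj_tidx !tidx1K !tidx2K; case: x y => ? ? [].
have Ap : psdk (fun i j => A i j).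
  apply: eq_psdk (psdk_comp (fun x => (tidx1 x, tidx2 x)) Kp) => x y.
  by rewrite /A choi_hsadj_tidx.
have [lam0 Alam] := lambda_min_psd (isT : (0 < 2 * 2)%N) Ap.
split; last first.
  move=> nonunital; apply: lambda_min_gt0 => // v v0 i.
  apply/eqP; apply: contra_notT nonunital => vi.
  (* A kernel vector of the Choi matrix, read on index pairs, is a kernel vector of [gramk N], and
     that forces [N] to be unital. *)
  pose w (x : 'I_2 * 'I_2) := v (tidx x.1 x.2).
  apply: (unital_of_gramk_kernel (v := w)) => //; last first.
    by exists (tidx1 i, tidx2 i); rewrite /w /= tidxK.
  have tidx_bij : bijective (fun x : 'I_2 * 'I_2 => tidx x.1 x.2).
    exists (fun x => (tidx1 x, tidx2 x)) => [[a b]|x] /=; last exact: tidxK.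
    by rewrite tidx1K tidx2K.
  rewrite -[RHS]v0 /sform [RHS](reindex _ (onW_bij _ tidx_bij)).
  apply: eq_bigr => x _ /=; rewrite [RHS](reindex _ (onW_bij _ tidx_bij)).
  by apply: eq_bigr => y _ /=; rewrite AE.
have Klam : psdk (fun x y => gramk N x y - lam%:C%C * (x == y)%:R).
  have := psdk_comp (fun x : 'I_2 * 'I_2 => tidx x.1 x.2) Alam.
  apply: eq_psdk => -[a i] [b j].
  by rewrite -/lam (AE (a, i) (b, j)) tidx_eq xpair_eqE.
apply: ge_ereal_sup => _ [rho [sigma [rq sq e0 ->]]]; rewrite lee_fin.
have lamC : 0 <= lam%:C%C by rewrite ler0c.
have Tlam := tensop_pow_gramk (k := k) lamC Klam.
(* The Gram kernel of the k-th tensor power is bounded below by [lam ^+ k], and [mu] is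
   [(lam / 4) ^+ k]. *)
apply: (@hockey_stick_contraction _ _ _ _ _ (lam ^+ k)) => //.
- exact: tensop_pow_choik.
- exact: tensop_pow_tp.
- by apply: eq_psdk Tlam => x y; rewrite rmorphXn.
exact: quarter_expr_le.
Qed.
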